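(* Let $q\ge 2$ be a real number and let $n\ge 1$ be an odd integer. Let $\mathcal{Q}_q$ be the distribution on $\mathbb{N}_0$ with mass function $$p_k=\frac{\prod_{i\ge1}(1-1/q^i)}{q^{k^2+k}\,(1-1/q^{k+1})\,\prod_{i=1}^k(1-1/q^i)^2},\qquad k\in\mathbb{N}_0,$$ and let $\mathcal{Q}_{q,n}$ be the distribution on $\{0,1,\dots,(n-1)/2\}$ with mass function $$p_{k,n}=\frac{N(n,n-2k-1)}{q^{(n-1)^2/4+(n-1)/2}},\qquad N(n,2h)=\prod_{j=0}^{(n-1)/2-h}\frac{q^{(n-1)/2+1}-q^j}{q^{(n-1)/2+1-h}-q^j}\ \prod_{i=0}^{h-1}(q^{(n-1)/2}-q^i).$$ Then $$\frac{1}{4\,q^{(n+3)/2}}\le\|\mathcal{Q}_{q,n}-\mathcal{Q}_q\|_{\mathrm{TV}}\le\frac{3}{q^{(n+3)/2}} .$$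
   Context: $\mathbb{N}_0=\{0,1,2,\dots\}$. Empty products equal $1$. For probability distributions $P_1,P_2$ on a countable set $S$, $\|P_1-P_2\|_{\mathrm{TV}}=\frac12\sum_{s\in S}|P_1(s)-P_2(s)|$; a distribution on $\{0,\dots,(n-1)/2\}$ is regarded as a distribution on $\mathbb{N}_0$. An $n\times n$ matrix $A$ is skew centrosymmetric if $A_{ij}=-A_{ji}$ and $A_{ij}=A_{n+1-j,n+1-i}$; for $q$ an odd prime power and $n$ odd, $p_{k,n}$ is the proportion of $n\times n$ skew centrosymmetric matrices over $\mathbb{F}_q$ having rank $n-2k-1$. *)

(* Defs.v *)
From HB Require Import structures.
From mathcomp Require Import all_boot all_order all_algebra.
From mathcomp Require Import all_classical all_reals all_analysis.
Import Order.TTheory GRing.Theory Num.Theory.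
Import numFieldNormedType.Exports.

Set Implicit Arguments.
Unset Strict Implicit.
Unset Printing Implicit Defensive.

Local Open Scope ring_scope.

(* Total variation distance of two distributions on a countable set, given by
   their mass functions.  [esum] is an unordered sum of nonnegative extended
   reals, so the value is meaningful without any summability hypothesis. *)
Definition dTV (R : realType) (S : countType) (P1 P2 : S -> R) : \bar R :=
  ((2^-1)%:E * \esum_(s in [set: S]) `|P1 s - P2 s|%:E)%E.

(* The infinite product of (1 - 1 / q ^ i) over i >= 1; the partial products
   are nonincreasing and nonnegative for q >= 1, so the limit exists. *)
Definition qprod_infty (R : realType) (q : R) : R :=
  limn (fun m : nat => \prod_(1 <= i < m.+1) (1 - 1 / q ^+ i)).

(* Mass function of Q_q. *)
Definition Qmass (R : realType) (q : R) (k : nat) : R :=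
  qprod_infty q /
  (q ^+ (k ^ 2 + k) * (1 - 1 / q ^+ k.+1) *
   \prod_(1 <= i < k.+1) (1 - 1 / q ^+ i) ^+ 2).

(* N(n, r) for n odd and r = 2h even, r <= n - 1; the inclusive upper bound
   (n-1)/2 - h of the first product becomes a strict bound on its successor. *)
Definition Nrank (R : realType) (q : R) (n r : nat) : R :=
  let m := ((n - 1) %/ 2)%N in
  let h := (r %/ 2)%N in
  (\prod_(0 <= j < (m - h).+1)
     ((q ^+ (m + 1) - q ^+ j) / (q ^+ (m + 1 - h) - q ^+ j))) *
  \prod_(0 <= i < h) (q ^+ m - q ^+ i).

(* Mass function of Q_{q,n} for n odd, extended by 0 from {0, ..., (n-1)/2} to
   all of nat; the divisions in the exponent are exact for n odd. *)
Definition Qnmass (R : realType) (q : R) (n k : nat) : R :=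
  if (k <= (n - 1) %/ 2)%N
  then Nrank q n (n - 2 * k - 1) /
       q ^+ ((n - 1) ^ 2 %/ 4 + (n - 1) %/ 2)
  else 0.

(* Main.v *)
Require Import Defs.
From HB Require Import structures.
From mathcomp Require Import all_boot all_order all_algebra.
From mathcomp Require Import all_classical all_reals all_analysis.
From mathcomp Require Import ring lra zify.
Import Order.TTheory GRing.Theory Num.Theory.
Import numFieldNormedType.Exports.
Local Open Scope ring_scope.

(** Write x = 1/q, so that 0 < x <= 1/2, write n = 2m+1, and let
    (x)_k = (1 - x) ... (1 - x^k), with limit (x)_oo.  Pulling the powers of q
    out of the products in N(n, 2h) gives

      p_k     = x^(k^2+k) / ((x)_k (x)_(k+1)) * (x)_oo,
      p_(k,n) = x^(k^2+k) / ((x)_k (x)_(k+1)) * (x)_(m+1) (x)_m / (x)_(m-k),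

    the second for k <= m ([Qmass_qpoch], [Qnmass_qpoch]).  The two masses thus
    share a weight and differ only in a last factor: (x)_(m+1) times the finite
    product of the 1 - x^i with m-k < i <= m on one side, times the tail of the
    1 - x^i with i > m+1 on the other.  Both products lie within a geometric
    sum of 1, by the Weierstrass inequality prod (1 - a_i) >= 1 - sum a_i
    ([qpoch_add_ge]), so they lie within that sum of each other.

    For k = 0 the finite product is 1, the tail differs from 1 by at least
    x^(m+2) and at most x^(m+2)/(1-x), and the common factor (x)_(m+1)/(1-x)
    lies in [1/2, 1]; this pins the gap between x^(m+2)/2 and 2 x^(m+2)
    ([Qmass_gap0]).
    For k >= 1 the weight x^(k^2+k) outweighs the loss x^(m-k+1), and the gap is
    at most x^(m+2) * 4/2^k ([Qmass_gap_succ], [gap_coeff_le]).  Half of the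
    term at 0 is the lower bound x^(m+2)/4; half of 2 + (2 + 1 + 1/2 + ...) = 6
    gives the constant 3.  Estimating the gaps one by one in absolute value
    avoids the q-series identities that say that the masses sum to 1. *)

(** * Finite q-Pochhammer products *)

(** The q-Pochhammer symbol (x; x)_k. *)
Definition qpoch (R : realFieldType) (x : R) (k : nat) : R :=
  \prod_(1 <= i < k.+1) (1 - x ^+ i).
Arguments qpoch {R} x k.

Lemma qpoch0 (R : realFieldType) (x : R) : qpoch x 0 = 1.
Proof. by rewrite /qpoch big_geq. Qed.

Lemma qpochS (R : realFieldType) (x : R) (k : nat) :
  qpoch x k.+1 = qpoch x k * (1 - x ^+ k.+1).
Proof. by rewrite /qpoch big_nat_recr. Qed.

Lemma qpoch1 (R : realFieldType) (x : R) : qpoch x 1 = 1 - x.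
Proof. by rewrite qpochS qpoch0 mul1r expr1. Qed.

Lemma qpoch_factor_ge (R : realFieldType) (x : R) (k : nat) :
  0 < x < 1 -> 1 - x <= 1 - x ^+ k.+1 < 1.
Proof.
move=> /andP[x0 x1]; rewrite lerD2l lerN2 exprS ger_pMr //.
by rewrite exprn_ile1 ?ltW //= gtrBl mulr_gt0 ?exprn_gt0.
Qed.

Lemma qpoch_gt0 (R : realFieldType) (x : R) (k : nat) :
  0 < x < 1 -> 0 < qpoch x k.
Proof.
move=> hx; elim: k => [|k IH]; first by rewrite qpoch0.
rewrite qpochS mulr_gt0 //.
by have := qpoch_factor_ge _ _ k hx; move: hx; lra.
Qed.

Lemma qpoch_ge0 (R : realFieldType) (x : R) (k : nat) :
  0 < x < 1 -> 0 <= qpoch x k.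
Proof. by move=> hx; rewrite ltW ?qpoch_gt0. Qed.

Lemma qpoch_nonincreasing (R : realFieldType) (x : R) :
  0 < x < 1 -> {homo qpoch x : i j / (i <= j)%N >-> j <= i}.
Proof.
move=> hx; apply/nonincreasing_seqP => k.
rewrite qpochS ger_pMr ?qpoch_gt0 //.
by have := qpoch_factor_ge _ _ k hx; lra.
Qed.

Lemma qpoch_le1 (R : realFieldType) (x : R) (k : nat) :
  0 < x < 1 -> qpoch x k <= 1.
Proof. by move=> hx; rewrite -(qpoch0 _ x) qpoch_nonincreasing. Qed.

(** Weierstrass' inequality for the factors a+1, ..., a+k; the subtracted term
    is the geometric sum x^(a+1) + ... + x^(a+k).  The exact finite sum is kept,
    since its factor 1 - x^k later cancels a factor of (x)_k; without that the
    bound on the gap at k = 1 would double when q = 2. *)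
Lemma qpoch_add_ge (R : realFieldType) (x : R) (a k : nat) : 0 < x < 1 ->
  qpoch x a * (1 - x ^+ a.+1 * (1 - x ^+ k) / (1 - x)) <= qpoch x (a + k).
Proof.
move=> hx; have [x0 x1] := andP hx.
elim: k => [|k IH]; first by rewrite addn0 expr0 subrr mulr0 mul0r subr0 mulr1.
rewrite addnS qpochS.
have [h1 h2] := andP (qpoch_factor_ge _ _ (a + k) hx).
apply: (@le_trans _ _ (qpoch x a * (1 - x ^+ a.+1 * (1 - x ^+ k) / (1 - x))
  * (1 - x ^+ (a + k).+1))); last by rewrite ler_wpM2r //; lra.
rewrite -[leRHS]mulrA ler_wpM2l ?qpoch_ge0 //.
have E : x ^+ a.+1 * (1 - x ^+ k.+1) / (1 - x) =
    x ^+ a.+1 * (1 - x ^+ k) / (1 - x) + x ^+ (a + k).+1.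
  by rewrite -addSn exprD (exprSr _ k); field; lra.
rewrite E; set s := x ^+ a.+1 * _ / _.
have s0 : 0 <= s.
  rewrite /s divr_ge0 ?mulr_ge0 ?exprn_ge0 ?subr_ge0 ?exprn_ile1 ?ltW //.
have t0 : 0 < x ^+ (a + k).+1 by rewrite exprn_gt0.
by move: s0 t0; move: s (x ^+ (a + k).+1) => s t; nra.
Qed.

Lemma qpoch_tail_ge (R : realFieldType) (x : R) (a k : nat) : 0 < x < 1 ->
  qpoch x a * (1 - x ^+ a.+1 / (1 - x)) <= qpoch x (a + k).
Proof.
move=> hx; have [x0 x1] := andP hx; apply: le_trans (qpoch_add_ge _ _ a k hx).
rewrite ler_wpM2l ?qpoch_ge0 // lerD2l lerN2 ler_wpM2r ?invr_ge0 //; first by lra.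
by rewrite ler_piMr ?exprn_ge0 ?ltW // gtrBl exprn_gt0.
Qed.

(** The factors from index 2 on multiply to at least
    1 - x^2/(1 - x) >= 1/2, because x <= 1/2. *)
Lemma qpoch_ge_half (R : realFieldType) (x : R) (k : nat) : 0 < x <= 1 / 2 ->
  (1 - x) / 2 <= qpoch x k.+1.
Proof.
move=> hx; have hx' : 0 < x < 1 by lra.
have := qpoch_tail_ge _ x 1 k hx'; rewrite add1n qpoch1; apply: le_trans.
have -> : (1 - x) * (1 - x ^+ 2 / (1 - x)) = 1 - x - x ^+ 2 by field; lra.
by nra.
Qed.

Lemma inv_lt1 (R : realFieldType) (q : R) : 2 <= q -> 0 < q^-1 < 1.
Proof. by move=> hq; rewrite invr_gt0 invf_lt1; lra. Qed.

Lemma inv_le_half (R : realFieldType) (q : R) : 2 <= q -> 0 < q^-1 <= 1 / 2.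
Proof. by move=> hq; rewrite invr_gt0 div1r lef_pV2 ?posrE; lra. Qed.

(** * The infinite product and the two mass functions *)

(** The partial products decrease, so the limit inherits the uniform bound
    [qpoch_tail_ge]. *)
Lemma qprod_infty_tail (R : realType) (q : R) (a : nat) : 2 <= q ->
  qpoch q^-1 a * (1 - q^-1 ^+ a.+1 / (1 - q^-1)) <= qprod_infty q <= qpoch q^-1 a.
Proof.
move=> hq; have hx := inv_lt1 _ _ hq.
have -> : qprod_infty q = limn (qpoch q^-1).
  rewrite /qprod_infty; congr (limn _); apply/funext => m.
  by apply: eq_bigr => i _; rewrite div1r exprVn.
have cv : cvgn (qpoch q^-1).
  apply: nonincreasing_is_cvgn; first exact: qpoch_nonincreasing.
  by exists 0 => _ [k _ <-]; rewrite qpoch_ge0.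
apply/andP; split; last by apply: nonincreasing_cvgn_ge => //; exact: qpoch_nonincreasing.
apply: limr_ge => //; exists a => // k /= ak.
by rewrite -(subnKC ak) qpoch_tail_ge.
Qed.

(** Each factor is q^N (1 - x^(N-j)), and the exponents N-j run down from N to
    N-l+1.  All the products in N(n, 2h) have this shape. *)
Lemma prod_subX (R : realFieldType) (q : R) (N l : nat) : 2 <= q -> (l <= N)%N ->
  \prod_(0 <= j < l) (q ^+ N - q ^+ j) =
  q ^+ (N * l) * (qpoch q^-1 N / qpoch q^-1 (N - l)).
Proof.
move=> hq; have hx := inv_lt1 _ _ hq.
have nz k : qpoch q^-1 k != 0 by rewrite gt_eqF ?qpoch_gt0.
elim: l => [|l IH] lN.
  by rewrite big_geq // muln0 subn0 divff // mulr1.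
rewrite big_nat_recr //= IH ?(ltnW lN) //.
have E : (N - l = (N - l.+1).+1)%N by lia.
rewrite E qpochS mulnS addnC exprD.
have q0 : q != 0 by lra.
have F : q ^+ N - q ^+ l = q ^+ N * (1 - q^-1 ^+ (N - l.+1).+1).
  by rewrite -E mulrBr mulr1 -{3}(subnK (ltnW lN)) exprD exprVn mulrAC divff ?mul1r // expf_neq0.
rewrite F.
have nf : 1 - q^-1 ^+ (N - l.+1).+1 != 0.
  by have := qpoch_factor_ge _ _ (N - l.+1) hx; move: hx; lra.
by field; rewrite nz nf.
Qed.

Lemma Qmass_qpoch (R : realType) (q : R) (k : nat) : 2 <= q ->
  Qmass q k =
  q^-1 ^+ (k ^ 2 + k) / (qpoch q^-1 k * qpoch q^-1 k.+1) * qprod_infty q.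
Proof.
move=> hq; have hx := inv_lt1 _ _ hq.
have nz j : qpoch q^-1 j != 0 by rewrite gt_eqF ?qpoch_gt0.
rewrite /Qmass prodrXl.
have -> : \prod_(1 <= i < k.+1) (1 - 1 / q ^+ i) = qpoch q^-1 k.
  by apply: eq_bigr => i _; rewrite div1r exprVn.
move: (nz k.+1); rewrite qpochS div1r !exprVn => nzS.
have q0 : q ^+ (k ^ 2 + k) != 0 by rewrite expf_neq0 //; lra.
have nk := nz k.
have nf : 1 - (q ^+ k.+1)^-1 != 0.
  by apply: contraNneq nzS => ->; rewrite mulr0.
move: nf; set t := (q ^+ k.+1)^-1 => nf.
by field; rewrite nk q0 nf.
Qed.

Lemma Qnmass_qpoch (R : realType) (q : R) (m k : nat) : 2 <= q -> (k <= m)%N ->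
  Qnmass q m.*2.+1 k =
  q^-1 ^+ (k ^ 2 + k) / (qpoch q^-1 k * qpoch q^-1 k.+1) *
  (qpoch q^-1 m.+1 * (qpoch q^-1 m / qpoch q^-1 (m - k))).
Proof.
move=> hq km; have hx := inv_lt1 _ _ hq.
have nz j : qpoch q^-1 j != 0 by rewrite gt_eqF ?qpoch_gt0.
rewrite /Qnmass /Nrank.
have -> : ((m.*2.+1 - 1) %/ 2 = m)%N by lia.
have -> : ((m.*2.+1 - 2 * k - 1) %/ 2 = m - k)%N by lia.
have -> : ((m.*2.+1 - 1) ^ 2 %/ 4 = m ^ 2)%N.
  by rewrite subn1 /= -mul2n expnMn mulKn.
rewrite km; have -> : (m - (m - k) = k)%N by lia.
have -> : (m + 1 - (m - k) = k.+1)%N by lia.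
(* N = m+1 and N = k+1 in the quotient, N = m in the last product *)
rewrite addn1 prodf_div !prod_subX ?leq_subr ?ltnS //.
have -> : (m.+1 - k.+1 = m - k)%N by lia.
have -> : (m - (m - k) = k)%N by lia.
rewrite subnn qpoch0 exprVn.
have q0 j : q ^+ j != 0 by rewrite expf_neq0 //; lra.
(* collecting the powers of q from the products and the normalisation leaves q^-(k^2 + k) *)
have E : q ^+ (m.+1 * k.+1) * q ^+ (m * (m - k)) * q ^+ (k ^ 2 + k) =
    q ^+ (k.+1 * k.+1) * q ^+ (m ^ 2 + m).
  rewrite -!exprD; congr (q ^+ _).
  by move: km => /subnKC; set d := (m - k)%N => <-; lia.
move: E (q0 (m.+1 * k.+1)%N) (q0 (m * (m - k))%N) (q0 (k ^ 2 + k)%N)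
  (q0 (k.+1 * k.+1)%N) (q0 (m ^ 2 + m)%N).
set A := q ^+ (m.+1 * _); set B := q ^+ (m * _); set C := q ^+ (k ^ 2 + k).
set D := q ^+ (k.+1 * _); set F := q ^+ (m ^ 2 + m) => E nA nB nC nD nF.
have -> : C^-1 = A * B / (D * F).
  by apply: (mulIf nC); rewrite mulVf // mulrAC E divff // mulf_neq0.
have n1 := nz k; have n2 := nz k.+1; have n3 := nz (m - k)%N.
by field; rewrite n1 n2 n3 nD nF.
Qed.

(** * Gaps between the masses *)

(** The weights aside, this compares p_(k,n) and p_k for k = j+1.  Writing
    L = (x)_(m+1) P, both P and (x)_m / (x)_(m-k) lie in [1 - d, 1], where
    d = x^(m-j) + ... + x^m: for the latter this is [qpoch_add_ge], for P it
    holds because the tail sum x^(m+2) / (1 - x) is below d. *)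
Lemma qpoch_ratio_gap (R : realFieldType) (x L : R) (m j : nat) :
  0 < x <= 1 / 2 -> (j < m)%N ->
  qpoch x m.+1 * (1 - x ^+ m.+2 / (1 - x)) <= L <= qpoch x m.+1 ->
  `|qpoch x m.+1 * (qpoch x m / qpoch x (m - j.+1)) - L| <=
  qpoch x m.+1 * (x ^+ (m - j) * (1 - x ^+ j.+1) / (1 - x)).
Proof.
move=> hx jm hL; have hx' : 0 < x < 1 by lra.
have P0 := qpoch_gt0 _ x m.+1 hx'.
have p0 := qpoch_gt0 _ x (m - j.+1) hx'.
have T1 : qpoch x m / qpoch x (m - j.+1) <= 1.
  by rewrite ler_pdivrMr // mul1r qpoch_nonincreasing // leq_subr.
have T2 : 1 - x ^+ (m - j) * (1 - x ^+ j.+1) / (1 - x) <=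
    qpoch x m / qpoch x (m - j.+1).
  rewrite ler_pdivlMr // mulrC.
  have := qpoch_add_ge _ x (m - j.+1) j.+1 hx'.
  by rewrite subnK // -subSn // subSS.
have D : x ^+ m.+2 / (1 - x) <= x ^+ (m - j) * (1 - x ^+ j.+1) / (1 - x).
  rewrite ler_wpM2r ?invr_ge0 //; first by lra.
  have -> : m.+2 = ((m - j) + j.+2)%N by lia.
  rewrite exprD ler_wpM2l ?exprn_ge0 //; first by lra.
  have : x ^+ j.+1 <= x by rewrite exprS ger_pMr ?exprn_ile1; lra.
  have : 0 < x ^+ j.+1 by rewrite exprn_gt0; lra.
  by rewrite (exprS _ j.+1); nra.
move: T1 T2 D hL; set T := qpoch x m / _; set d := x ^+ (m - j) * _ / _.
set e := _ / _ => T1 T2 D /andP[L1 L2].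
rewrite ler_norml; apply/andP; split; nra.
Qed.

(** For k = j+1 <= m the weight times the bound of [qpoch_ratio_gap] gives
    the right-hand side: 1 - x^k cancels a factor of (x)_k, the denominator
    (x)_(k+1) absorbs the smaller (x)_(m+1), and k^2 + k + m - j = (m+2) + (j^2 + 2j).  For k > m the gap is
    p_k itself, and x^(k^2+k) is already small enough since k >= m+1. *)
Lemma Qmass_gap_succ (R : realType) (q : R) (m j : nat) : 2 <= q ->
  `|Qnmass q m.*2.+1 j.+1 - Qmass q j.+1| <=
  q^-1 ^+ m.+2 * (q^-1 ^+ (j ^ 2 + 2 * j) / ((1 - q^-1) * qpoch q^-1 j)).
Proof.
move=> hq; have hx := inv_le_half _ _ hq.
have hx' : 0 < q^-1 < 1 by lra.
have pj := qpoch_gt0 _ _ j hx'.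
have pk := qpoch_gt0 _ _ j.+1 hx'.
have pk1 := qpoch_gt0 _ _ j.+2 hx'.
have [f1 f2] := andP (qpoch_factor_ge _ _ j hx').
have W0 : 0 < q^-1 ^+ (j.+1 ^ 2 + j.+1) / (qpoch q^-1 j.+1 * qpoch q^-1 j.+2).
  by rewrite divr_gt0 ?mulr_gt0 ?exprn_gt0 //; lra.
case: (leqP j.+1 m) => jm.
- rewrite Qnmass_qpoch // Qmass_qpoch // -mulrBr normrM (gtr0_norm W0).
  have := qpoch_ratio_gap _ _ _ m j hx jm (qprod_infty_tail _ _ m.+1 hq).
  move=> /(ler_wpM2l (ltW W0)) /le_trans; apply.
  have mono : qpoch q^-1 m.+1 <= qpoch q^-1 j.+2 by rewrite qpoch_nonincreasing.
  apply: (@le_trans _ _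
    (q^-1 ^+ (j.+1 ^ 2 + j.+1) / (qpoch q^-1 j.+1 * qpoch q^-1 j.+2) *
     (qpoch q^-1 j.+2 * (q^-1 ^+ (m - j) * (1 - q^-1 ^+ j.+1) / (1 - q^-1))))).
    apply: (ler_wpM2l (ltW W0)); apply: ler_wpM2r mono.
    by rewrite divr_ge0 ?mulr_ge0 ?exprn_ge0; lra.
  rewrite le_eqVlt; apply/orP; left; apply/eqP.
  have E : q^-1 ^+ (j.+1 ^ 2 + j.+1) * q^-1 ^+ (m - j) =
      q^-1 ^+ m.+2 * q^-1 ^+ (j ^ 2 + 2 * j).
    rewrite -!exprD; congr (_ ^+ _).
    by move: (subnKC (ltnW jm)); set d := (m - j)%N => <-; lia.
  transitivity (q^-1 ^+ (j.+1 ^ 2 + j.+1) * q^-1 ^+ (m - j) /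
    ((1 - q^-1) * qpoch q^-1 j)); last by rewrite E mulrA.
  have nq : q != 0 by lra.
  have nq1 : q - 1 != 0 by lra.
  have nt : 1 - q^-1 ^+ j.+1 != 0 by lra.
  rewrite qpochS; field; rewrite nq nq1 nt !gt_eqF //.
- have -> : Qnmass q m.*2.+1 j.+1 = 0.
    by rewrite /Qnmass ifF //; apply/negbTE; lia.
  have /andP[_ L1] := qprod_infty_tail _ _ j.+2 hq.
  have L0 : 0 <= qprod_infty q.
    have := qprod_infty_tail _ _ 0 hq; rewrite qpoch0 expr1 mul1r.
    have : q^-1 / (1 - q^-1) <= 1 by rewrite ler_pdivrMr; lra.
    by lra.
  rewrite sub0r normrN Qmass_qpoch // ger0_norm; last exact: mulr_ge0 (ltW W0) L0.
  apply: (@le_trans _ _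
    (q^-1 ^+ (j.+1 ^ 2 + j.+1) / (qpoch q^-1 j.+1 * qpoch q^-1 j.+2) *
     qpoch q^-1 j.+2)).
    by rewrite ler_wpM2l ?(ltW W0).
  have -> : q^-1 ^+ (j.+1 ^ 2 + j.+1) / (qpoch q^-1 j.+1 * qpoch q^-1 j.+2) *
     qpoch q^-1 j.+2 = q^-1 ^+ (j.+1 ^ 2 + j.+1) / qpoch q^-1 j.+1.
    by field; rewrite !gt_eqF.
  rewrite mulrA -exprD.
  apply: ler_pM; rewrite ?invr_ge0 ?exprn_ge0 ?qpoch_ge0 //; first by lra.
    rewrite ler_wiXn2l //; [lra|lra|].
    by nia.
  rewrite qpochS mulrC lef_pV2 ?posrE ?mulr_gt0 //; [|lra|lra].
  by rewrite ler_wpM2r // ltW.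
Qed.

(** Equality holds at j = 0, x = 1/2.  For j >= 1 the denominator is at least
    (1 - x)^2/2 >= 1/8 and j^2 + 2j >= j + 2. *)
Lemma gap_coeff_le (R : realFieldType) (x : R) (j : nat) : 0 < x <= 1 / 2 ->
  x ^+ (j ^ 2 + 2 * j) / ((1 - x) * qpoch x j) <= 2 / 2 ^+ j.
Proof.
move=> hx; have hx' : 0 < x < 1 by lra.
case: j => [|j].
  by rewrite qpoch0 expr0 mulr1 divr1 ler_pdivrMr; lra.
have h := qpoch_ge_half _ _ j hx.
have p0 := qpoch_gt0 _ _ j.+1 hx'.
rewrite ler_pdivrMr; last by rewrite mulr_gt0 //; lra.
apply: (@le_trans _ _ (2 / 2 ^+ j.+1 / 8)).
  apply: (@le_trans _ _ (2^-1 ^+ (j.+3))); last first.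
    by rewrite le_eqVlt; apply/orP; left; apply/eqP; rewrite !exprS exprVn; field; rewrite expf_neq0.
  apply: (@le_trans _ _ (x ^+ j.+3)).
    by rewrite ler_wiXn2l //; [lra|lra|nia].
  by rewrite lerXn2r ?nnegrE; lra.
rewrite ler_wpM2l ?divr_ge0 ?exprn_ge0 //.
by nra.
Qed.

(** At k = 0 the gap is ((x)_(m+1) - (x)_oo) / (1 - x), and the relative
    difference of (x)_(m+1) and (x)_oo lies between the first omitted term
    x^(m+2) and the whole tail sum x^(m+2)/(1 - x). *)
Lemma Qmass_gap0 (R : realType) (q : R) (m : nat) : 2 <= q ->
  q^-1 ^+ m.+2 / 2 <= `|Qnmass q m.*2.+1 0 - Qmass q 0| <= 2 * q^-1 ^+ m.+2.
Proof.
move=> hq; have hx := inv_le_half _ _ hq.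
have hx' : 0 < q^-1 < 1 by lra.
have P0 := qpoch_gt0 _ _ m.+1 hx'.
rewrite Qnmass_qpoch // Qmass_qpoch // -mulrBr.
rewrite expr0 qpoch0 qpoch1 mul1r mul1r subn0 divff ?gt_eqF ?qpoch_gt0 // mulr1.
have [L1 _] := andP (qprod_infty_tail _ _ m.+1 hq).
have [_ L2] := andP (qprod_infty_tail _ _ m.+2 hq).
have H1 := qpoch_ge_half _ _ m hx.
have H2 : qpoch q^-1 m.+1 <= 1 - q^-1 by rewrite -qpoch1 qpoch_nonincreasing.
move: L2; rewrite qpochS => L2.
have t0 : 0 < q^-1 ^+ m.+2 by rewrite exprn_gt0; lra.
have D : q^-1 ^+ m.+2 / (1 - q^-1) <= 2 * q^-1 ^+ m.+2.
  by rewrite ler_pdivrMr; nra.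
rewrite ger0_norm; last by rewrite mulr_ge0 ?invr_ge0; nra.
rewrite [_^-1 * (_ - _)]mulrC ler_pdivlMr ?ler_pdivrMr; [|lra|lra].
by apply/andP; split; nra.
Qed.

(** * Summation *)

Lemma Qmass_gap_le (R : realType) (q : R) (m k : nat) : 2 <= q ->
  `|Qnmass q m.*2.+1 k - Qmass q k| <=
  q^-1 ^+ m.+2 * (if k is j.+1 then 2 / 2 ^+ j else 2).
Proof.
move=> hq; have hx := inv_le_half _ _ hq.
case: k => [|j].
  by have := Qmass_gap0 _ _ m hq; rewrite [_ * 2]mulrC => /andP[].
apply: le_trans (Qmass_gap_succ _ _ m j hq) _.
by rewrite ler_wpM2l ?gap_coeff_le // exprn_ge0; lra.
Qed.

Lemma esum_le_partial (R : realType) (a : nat -> R) (c : R) :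
  (forall k, 0 <= a k) -> (forall N, \sum_(0 <= k < N) a k <= c) ->
  (\esum_(k in [set: nat]) (a k)%:E <= c%:E)%E.
Proof.
move=> a0 ac; rewrite -nneseries_esumT; last by move=> k; rewrite lee_fin.
apply: lime_le.
  by apply: is_cvg_nneseries => k _ _; rewrite lee_fin.
by apply: nearW => N; rewrite sumEFin lee_fin.
Qed.

Lemma le_esum_term (R : realType) (a : nat -> R) (k : nat) :
  ((a k)%:E <= \esum_(i in [set: nat]) (a i)%:E)%E.
Proof.
by apply: esum_ge; exists [set k]%classic; rewrite ?fsbig_set1 //; exact: fsets_set1.
Qed.

Lemma gap_bound_sum_le (R : realFieldType) (N : nat) :
  \sum_(0 <= k < N) (if k is j.+1 then 2 / 2 ^+ j else 2) <= 6 :> R.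
Proof.
have E M : \sum_(0 <= k < M.+1) (if k is j.+1 then 2 / 2 ^+ j else 2) =
    6 - 4 / 2 ^+ M :> R.
  elim: M => [|M IH]; first by rewrite big_nat1 expr0; lra.
  by rewrite big_nat_recr //= IH exprS; field; rewrite expf_neq0.
case: N => [|N]; first by rewrite big_geq.
by rewrite E gerBl divr_ge0 ?exprn_ge0.
Qed.

Theorem theorem6p2 (R : realType) (q : R) (n : nat)
    (hq : 2 <= q) (hn1 : (1 <= n)%N) (hn : odd n) :
  ((1 / (4 * q ^+ ((n + 3) %/ 2)))%:E <= dTV (Qnmass q n) (Qmass q))%E /\
  (dTV (Qnmass q n) (Qmass q) <= (3 / q ^+ ((n + 3) %/ 2))%:E)%E.
Proof.
have [m ->] : exists m, n = m.*2.+1 by exists n./2; lia.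
have -> : ((m.*2.+1 + 3) %/ 2 = m.+2)%N by lia.
rewrite /dTV; set a := fun k => `|Qnmass q m.*2.+1 k - Qmass q k|.
have half0 : (0 <= (2^-1 : R)%:E)%E by rewrite lee_fin.
split.
- apply: le_trans (lee_wpmul2l half0 (le_esum_term _ a 0%N)).
  rewrite -EFinM lee_fin.
  have : q^-1 ^+ m.+2 / 2 <= a 0%N by have /andP[] := Qmass_gap0 _ _ m hq.
  by rewrite exprVn div1r (invfM 4); lra.
- have S : (\esum_(k in [set: nat]) (a k)%:E <= (6 / q ^+ m.+2)%:E)%E.
    apply: esum_le_partial => [k|N]; first exact: normr_ge0.
    apply: (@le_trans _ _ (\sum_(0 <= k < N)
      q^-1 ^+ m.+2 * (if k is j.+1 then 2 / 2 ^+ j else 2))).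
      by apply: ler_sum => k _; exact: Qmass_gap_le.
    rewrite -mulr_sumr mulrC exprVn ler_wpM2r ?gap_bound_sum_le //.
    by rewrite invr_ge0 exprn_ge0; lra.
  apply: le_trans (lee_wpmul2l half0 S) _.
  by rewrite -EFinM lee_fin; lra.
Qed.
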